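(* Let $S$ be a semigroup generated by $A\subseteq S$, let $T$ be a subsemigroup of $S$, let $\{H_i : i\in I\}$ be the $T$-relative $\mathscr{H}$-classes contained in $S\setminus T$ with representatives $h_i\in H_i$, and let $\sigma : S^1\times I^1\to T^1$ and $\tau : I^1\times S^1\to T^1$ be fixed mappings satisfying $sh_i=h_{\rho(s,i)}\sigma(s,i)$ and $h_is=\tau(i,s)h_{\lambda(i,s)}$ for all $i\in I^1$, $s\in S^1$. Then $T$ is generated by the set \[ B=\{\tau(i,\sigma(a,j)) : i,j\in I^1,\ a\in A\}, \] where the adjoined identity $1\notin S$ is disregarded if it occurs in $B$ (that is, $T$ is the subsemigroup generated by $B\setminus\{1\}$). In particular, if $S$ is finitely generated and $T$ has finite Green index in $S$, then $T$ is finitely generated.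
   Context: For a semigroup $S$, $S^1=S\cup\{1\}$ denotes $S$ with a new identity element $1\notin S$ adjoined (even if $S$ already has an identity); for $X\subseteq S$, $X^1=X\cup\{1\}$. For a subsemigroup $T$ of $S$ and $u,v\in S$: $u\,\mathscr{R}^T v$ iff $uT^1=vT^1$; $u\,\mathscr{L}^T v$ iff $T^1u=T^1v$; $\mathscr{H}^T=\mathscr{R}^T\cap\mathscr{L}^T$. The classes of $\mathscr{H}^T$ are the $T$-relative $\mathscr{H}$-classes; each lies wholly in $T$ or wholly in $S\setminus T$. The Green index of $T$ in $S$ is one more than the number of $T$-relative $\mathscr{H}$-classes contained in $S\setminus T$. Put $I^1=I\cup\{1\}$ with $1\notin I$, and set $H_1=\{1\}$, $h_1=1$ (the adjoined identity). The mappings $\rho:S^1\times I^1\to I^1$ and $\lambda:I^1\times S^1\to I^1$ are defined by: $\rho(s,i)=j$ if $sh_i\in H_j$, and $\rho(s,i)=1$ if $sh_i\in T$; $\lambda(i,s)=j$ if $h_is\in H_j$, and $\lambda(i,s)=1$ if $h_is\in T$. Mappings $\sigma,\tau$ with the stated properties always exist. *)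

(* Defs.v *)
From HB Require Import structures.
From mathcomp Require Import all_boot.
From mathcomp Require Import boolp classical_sets functions cardinality.

Set Implicit Arguments.
Unset Strict Implicit.
Unset Printing Implicit Defensive.

Local Open Scope group_scope.
Local Open Scope classical_set_scope.

(* S^1: [None] is the new identity, adjoined even when S already has one. *)
Definition adj1 (S : semigroupType) : Type := option S.

Section Adj1.
Variable S : semigroupType.

HB.instance Definition _ := Choice.copy (adj1 S) (option S).

Definition adj1_mul (x y : adj1 S) : adj1 S :=
  match x, y with
  | Some s, Some t => Some (s * t)
  | None, _ => y
  | _, None => x
  end.

Fact adj1_mulA : associative adj1_mul.
Proof. by move=> [x|] [y|] [z|] //=; rewrite mulgA. Qed.

Fact adj1_mul1 : left_id (None : adj1 S) adj1_mul.
Proof. by case. Qed.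

Fact adj1_mulr1 : right_id (None : adj1 S) adj1_mul.
Proof. by case. Qed.

HB.instance Definition _ :=
  isMonoid.Build (adj1 S) adj1_mulA adj1_mul1 adj1_mulr1.

Definition in1 (s : S) : adj1 S := Some s.

Definition set1adj (X : set S) : set (adj1 S) := [set 1] `|` in1 @` X.

(* The empty set counts as a subsemigroup. *)
Definition subsemigroup (T : set S) : Prop :=
  forall x y, T x -> T y -> T (x * y).

Definition gen (A : set S) : set S := smallest subsemigroup A.

Definition fin_gen (T : set S) : Prop :=
  exists2 A : set S, finite_set A & gen A = T.

Definition relR (T : set S) (u v : S) : Prop :=
  [set in1 u * t | t in set1adj T] = [set in1 v * t | t in set1adj T].

Definition relL (T : set S) (u v : S) : Prop :=
  [set t * in1 u | t in set1adj T] = [set t * in1 v | t in set1adj T].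

Definition relH (T : set S) (u v : S) : Prop := relR T u v /\ relL T u v.

Definition relHclass (T : set S) (u : S) : set S := [set v | relH T u v].

Definition outerHclasses (T : set S) : set (set S) :=
  [set C | (exists u, C = relHclass T u) /\ C `<=` ~` T].

Definition green_index (T : set S) (n : nat) : Prop :=
  exists2 m, (outerHclasses T #= `I_m)%card & n = m.+1.

Definition finite_green_index (T : set S) : Prop :=
  exists n, green_index T n.

End Adj1.

(* I^1 is [option I], its adjoined element 1 being [None]; H_1 = {1} and h_1 = 1
   are taken in S^1. *)
Section Action.
Variables (S : semigroupType) (I : Type).

Definition extH (H : I -> set S) (i : option I) : set (adj1 S) :=
  if i is Some j then @in1 S @` H j else [set 1].

Definition exth (h : I -> S) (i : option I) : adj1 S :=
  if i is Some j then in1 (h j) else 1.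

(* When H enumerates the T-relative H-classes outside T without repetition,
   exactly one of the two cases below applies to each (s, i), and the j of the
   first is unique; so rho and lambda are determined by these predicates.
   Taking j in I^1 covers s = i = 1. *)
Definition is_rho (T : set S) (H : I -> set S) (h : I -> S)
    (rho : adj1 S -> option I -> option I) : Prop :=
  forall (s : adj1 S) i,
    (forall j, extH H j (s * exth h i) -> rho s i = j) /\
    ((@in1 S @` T) (s * exth h i) -> rho s i = None).

Definition is_lambda (T : set S) (H : I -> set S) (h : I -> S)
    (lambda : option I -> adj1 S -> option I) : Prop :=
  forall i (s : adj1 S),
    (forall j, extH H j (exth h i * s) -> lambda i s = j) /\
    ((@in1 S @` T) (exth h i * s) -> lambda i s = None).

Definition genB (A : set S) (sigma : adj1 S -> option I -> adj1 S)
    (tau : option I -> adj1 S -> adj1 S) : set (adj1 S) :=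
  [set b | exists i j a, A a /\ b = tau i (sigma (in1 a) j)].

End Action.

(* Main.v *)
Require Import Defs.
From mathcomp Require Import all_boot.
From mathcomp Require Import boolp classical_sets functions cardinality.

(** Let C be the set of all sigma(a, j) with a in A, so that B consists of all
    tau(i, c) with c in C. Pushing representatives through words twice rewrites
    an element of T over B.

    From right to left: a h_j = h_k sigma(a, j) with k = rho(a, j), so an element
    s = a_1 ... a_n of S, written as a_1 ... a_n h_1, becomes h_k w for a word w
    over C (lemma [sigmas_words]).

    From left to right: h_i c = tau(i, c) h_l with l = lambda(i, c), so h_k w
    becomes b h_l for a word b over B. In general h_l need not be 1; it is when s
    lies in T (lemma [push_words]). To see this, let h_i c v be an element of T^1
    with c in C and v a word over C. If h_i c lies in T, then l = 1 and what is
    left to rewrite is v, a product of elements of T^1. Otherwise h_i c is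
    L^T-related to h_l, so that h_l belongs to T^1 h_i c and h_l v to
    T^1 h_i c v, which is inside T^1. Hence the part that is still to be
    rewritten stays in T^1, and once the word is used up this part is h_l alone,
    which forces l = 1.

    For the finiteness statement, every element of S^1 is in T or in exactly one
    extended class, so index functions and multipliers exist by choice; B is then
    a finite set, being indexed by I^1 x I^1 x A. *)

Local Open Scope group_scope.
Local Open Scope classical_set_scope.

Set Implicit Arguments.
Unset Strict Implicit.
Unset Printing Implicit Defensive.

(** * Subsemigroups and words *)

Section Generation.
Variable S : semigroupType.
Implicit Types (A T : set S) (X : set (adj1 S)) (x y : adj1 S).

Lemma gen_subsemigroup A : subsemigroup (gen A).
Proof.
move=> x y Ax Ay X [subX AX].
by apply: (subX); [apply: Ax | apply: Ay].
Qed.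

Lemma sub_gen A : A `<=` gen A.
Proof. exact: sub_smallest. Qed.

Lemma gen_min A T : subsemigroup T -> A `<=` T -> gen A `<=` T.
Proof. exact: smallest_sub. Qed.

Lemma set1adj1 T : set1adj T 1.
Proof. by left. Qed.

Lemma set1adj_in1 T (s : S) : set1adj T (in1 s) <-> T s.
Proof.
split=> [[//|[t Tt [<-]] //]|Ts]; by right; exists s.
Qed.

Lemma set1adjM T x y :
  subsemigroup T -> set1adj T x -> set1adj T y -> set1adj T (x * y).
Proof.
move=> subT [->|[s Ts <-]]; first by rewrite mul1g.
move=> [->|[t Tt <-]]; first by rewrite mulg1; right; exists s.
by right; exists (s * t) => //; apply: subT.
Qed.

(** The submonoid generated by [X]. The words are built letter by letter on the
    left, because that is the order in which an outer representative standing
    to their left moves through them. *)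
Inductive words X : set (adj1 S) :=
| words1 : words X 1
| words_cons x w : X x -> words X w -> words X (x * w).

Lemma wordsM X x y : words X x -> words X y -> words X (x * y).
Proof.
move=> Xx Xy; elim: Xx => [|z w Xz _ IHw]; first by rewrite mul1g.
by rewrite -mulgA; apply: words_cons.
Qed.

Lemma words_set1adj T X x :
  subsemigroup T -> X `<=` set1adj T -> words X x -> set1adj T x.
Proof.
move=> subT XT; elim=> [|z w Xz _ IHw]; first exact: set1adj1.
by apply: set1adjM => //; apply: XT.
Qed.

Lemma relRP T (u v : S) :
  relR T u v -> exists2 t, set1adj T t & in1 v = in1 u * t.
Proof.
move=> uv; have : [set in1 v * t | t in set1adj T] (in1 v).
  by exists 1; [exact: set1adj1 | rewrite mulg1].
by rewrite -uv => -[t Tt <-]; exists t.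
Qed.

Lemma relLP T (u v : S) :
  relL T u v -> exists2 t, set1adj T t & in1 v = t * in1 u.
Proof.
move=> uv; have : [set t * in1 v | t in set1adj T] (in1 v).
  by exists 1; [exact: set1adj1 | rewrite mul1g].
by rewrite -uv => -[t Tt <-]; exists t.
Qed.

(** A relative class that meets [T] lies inside [T]: an element R^T-related to an
    element [v] of [T] belongs to v T^1. *)
Lemma relHclass_outer T (u : S) :
  subsemigroup T -> ~ T u -> outerHclasses T (relHclass T u).
Proof.
move=> subT Tu; split; first by exists u.
move=> v [/esym /relRP [t Tt uE] _] Tv; apply: Tu.
by apply/set1adj_in1; rewrite uE; apply: set1adjM => //; apply/set1adj_in1.
Qed.

End Generation.

(** * Relative H-classes outside the subsemigroup *)

Section Classes.
Variables (S : semigroupType) (T : set S) (I : Type) (H : I -> set S) (h : I -> S).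
Hypothesis subT : subsemigroup T.
Hypothesis injH : injective H.
Hypothesis rangeH : range H = outerHclasses T.
Hypothesis repr_h : forall i, H i (h i).

Lemma repr_notin i : ~ T (h i).
Proof.
have : outerHclasses T (H i) by rewrite -rangeH; exists i.
by move=> [_]; apply.
Qed.

Lemma T_or_extH (x : adj1 S) : (@in1 S @` T) x \/ exists j, extH H j x.
Proof.
case: x => [s|]; last by right; exists None.
have [Ts|nTs] := pselect (T s); first by left; exists s.
have : outerHclasses T (relHclass T s) by apply: relHclass_outer.
rewrite -rangeH => -[i _ Hi]; right; exists (Some i), s => //.
by rewrite Hi; split.
Qed.

Lemma extH_notin j (x : adj1 S) : extH H j x -> ~ (@in1 S @` T) x.
Proof.
case: j => [i|->] /=; last by case.
move=> [s His <-] [t Tt [ts]]; rewrite -ts in His.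
have : outerHclasses T (H i) by rewrite -rangeH; exists i.
by move=> [_ /(_ _ His)]; apply.
Qed.

Lemma class_relH_repr i (s : S) : H i s -> relH T s (h i).
Proof.
have : outerHclasses T (H i) by rewrite -rangeH; exists i.
move=> [[u Hu] _]; have := repr_h i; rewrite Hu.
by move=> [Ruh Luh] [Rus Lus]; split; [rewrite /relR -Rus|rewrite /relL -Lus].
Qed.

Lemma extH_inj i j (x : adj1 S) : extH H i x -> extH H j x -> i = j.
Proof.
case: i => [i|->]; case: j => [j|] //=; last 2 first.
- by move=> [s _ <-].
- by case.
move=> [s His <-] [t Hjt [ts]]; rewrite ts in Hjt; congr Some; apply: injH.
have : outerHclasses T (H i) by rewrite -rangeH; exists i.
have : outerHclasses T (H j) by rewrite -rangeH; exists j.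
move=> [[v Hv] _] [[u Hu] _]; move: His Hjt; rewrite Hu Hv.
move=> [Rus Lus] [Rvs Lvs]; apply/seteqP; split=> y [Ry Ly]; split.
- by rewrite /relR Rvs -Rus.
- by rewrite /relL Lvs -Lus.
- by rewrite /relR Rus -Rvs.
- by rewrite /relL Lus -Lvs.
Qed.

(** The half of H^T-relatedness on which the left-to-right rewriting rests: the
    multiplier stands on the left, so it survives further multiplication on the
    right. *)
Lemma extH_left j (x : adj1 S) :
  extH H j x -> exists2 t, set1adj T t & exth h j = t * x.
Proof.
case: j => [i [s Hs <-]|->] /=.
- by have [_ /relLP] := class_relH_repr Hs.
- by exists 1; [exact: set1adj1 | rewrite mul1g].
Qed.

(** Since the index depends only on the product, one function of [x] supplies
    both rho (take [x] to be s h_i) and lambda (take [x] to be h_i s). *)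
Lemma index_exists (x : adj1 S) : exists j : option I,
  [/\ forall k, extH H k x -> j = k,
      (@in1 S @` T) x -> j = None,
      exists2 t, set1adj T t & x = exth h j * t &
      exists2 t, set1adj T t & x = t * exth h j].
Proof.
have [Tx|[j Hj]] := T_or_extH x.
  exists None; split=> //.
  - by move=> k /extH_notin.
  - by exists x; [right | rewrite mul1g].
  - by exists x; [right | rewrite mulg1].
exists j; split=> [k|Tx||].
- exact: extH_inj.
- by case: (extH_notin Hj).
- case: j Hj => [i [s Hs <-]|->] /=; last by exists 1; [exact: set1adj1|].
  by have [/esym /relRP] := class_relH_repr Hs.
- case: j Hj => [i [s Hs <-]|->] /=; last by exists 1; [exact: set1adj1|].
  by have [_ /esym /relLP] := class_relH_repr Hs.
Qed.

(** * Pushing representatives through words *)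

Section Rewriting.
Variables (A : set S).
Hypothesis genA : gen A = setT.
Variables (rho : adj1 S -> option I -> option I)
  (lambda : option I -> adj1 S -> option I).
Hypothesis lambdaP : is_lambda T H h lambda.
Variables (sigma : adj1 S -> option I -> adj1 S)
  (tau : option I -> adj1 S -> adj1 S).
Hypothesis sigmaT : forall s i, set1adj T (sigma s i).
Hypothesis tauT : forall i s, set1adj T (tau i s).
Hypothesis sigmaP :
  forall (s : adj1 S) i, s * exth h i = exth h (rho s i) * sigma s i.
Hypothesis tauP :
  forall i (s : adj1 S), exth h i * s = tau i s * exth h (lambda i s).

Definition sigmas : set (adj1 S) :=
  [set x | exists a j, A a /\ x = sigma (in1 a) j].

(** The elements [s] for which this holds at every index [j] form a subsemigroup,
    because [k] is again an index to which the next letter can be applied. *)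
Lemma sigmas_words (s : S) j :
  exists k w, words sigmas w /\ in1 s * exth h j = exth h k * w.
Proof.
pose P := [set s : S | forall j, exists k w,
  words sigmas w /\ in1 s * exth h j = exth h k * w].
suff: gen A `<=` P by rewrite genA => /(_ s Logic.I j).
apply: gen_min => [x y Px Py i|a Aa i].
  have [k [w [Xw yE]]] := Py i; have [l [v [Xv xE]]] := Px k.
  exists l, (v * w); split; first exact: wordsM.
  have -> : in1 (x * y) = in1 x * in1 y by [].
  by rewrite -mulgA yE mulgA xE mulgA.
exists (rho (in1 a) i), (sigma (in1 a) i * 1); split.
  by apply: words_cons (words1 _); exists a, i.
by rewrite mulg1 sigmaP.
Qed.

Lemma sigmas_sub : sigmas `<=` set1adj T.
Proof. by move=> _ [a [j [_ ->]]]. Qed.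

(** Membership of the whole product in T^1 is the invariant: it passes to the
    shorter product that is left after one letter, and for the empty word it
    excludes every representative except 1. *)
Lemma push_words (w : adj1 S) i : words sigmas w -> set1adj T (exth h i * w) ->
  words (genB A sigma tau) (exth h i * w).
Proof.
move=> Xw; elim: Xw i => [|x v Xx Xv IHv] i Tiw.
  case: i Tiw => [i|_]; last by rewrite mulg1; exact: words1.
  by rewrite mulg1 => /set1adj_in1 /repr_notin.
rewrite mulgA tauP -mulgA; apply: words_cons.
  by have [a [j [Aa ->]]] := Xx; exists i, j, a.
(* The invariant for the remaining product, whose index is lambda i x. *)
apply: IHv; have [lambdaH lambdaT] := lambdaP i x.
have [Tix|[j Hj]] := T_or_extH (exth h i * x).
  by rewrite lambdaT // mul1g; exact: words_set1adj sigmas_sub Xv.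
rewrite (lambdaH j Hj); have [t Tt ->] := extH_left Hj.
by rewrite -!mulgA; apply: set1adjM.
Qed.

Lemma subsemigroup_genB : T = gen (@in1 S @^-1` genB A sigma tau).
Proof.
apply/seteqP; split; last first.
  apply: gen_min => // s [i [j [a [_ sE]]]].
  by apply/set1adj_in1; rewrite sE.
move=> s Ts; have [k [w [Xw]]] := sigmas_words s None.
rewrite mulg1 => sE; apply/set1adj_in1.
(* The letter 1 may occur in B; it contributes nothing to the product. *)
have : words (genB A sigma tau) (in1 s).
  by rewrite sE; apply: push_words => //; rewrite -sE; apply/set1adj_in1.
apply: words_set1adj; first exact: gen_subsemigroup.
move=> [b Bb|_]; last exact: set1adj1.
by apply/set1adj_in1; apply: sub_gen.
Qed.

End Rewriting.

End Classes.

(** * Finite generation *)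

Lemma finite_genB (S : semigroupType) (I : Type) (A : set S)
    (sigma : adj1 S -> option I -> adj1 S) (tau : option I -> adj1 S -> adj1 S) :
  finite_set [set: I] -> finite_set A -> finite_set (genB A sigma tau).
Proof.
move=> finI finA.
have finoI : finite_set [set: option I].
  have -> : [set: option I] = [set None] `|` Some @` [set: I].
    by apply/seteqP; split=> // -[i|] _; [right; exists i | left].
  by rewrite finite_setU; split; [exact: finite_set1 | exact: finite_image].
have -> : genB A sigma tau =
    [set tau i x | i in [set: option I] &
                   x in [set sigma (in1 a) j | a in A & j in [set: option I]]].
  apply/seteqP; split=> [_ [i [j [a [Aa ->]]]]|_ [i _ [_ [a Aa [j _ <-]] <-]]].
    by exists i => //; exists (sigma (in1 a) j) => //; exists a => //; exists j.
  by exists i, j, a.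
by do 2!apply: finite_image2 => //.
Qed.

Lemma fin_gen_finite_green_index (S : semigroupType) (T : set S) :
  subsemigroup T -> fin_gen [set: S] -> finite_green_index T -> fin_gen T.
Proof.
move=> subT [A finA genA] [_ [m cardT _]].
pose I := {C : set S | outerHclasses T C}.
pose H (i : I) := sval i.
have injH : injective H.
  by move=> [C PC] [D PD]; rewrite /H /= => CD; exact: eq_exist.
have rangeH : range H = outerHclasses T.
  by apply/seteqP; split=> [_ [[C PC] _ <-] //|C PC]; exists (exist _ C PC).
have /choice[h repr_h] : forall i, exists s, H i s.
  by move=> [C C_out]; have [[u Cu] _] := C_out; exists u; rewrite /H /= Cu.
have [c cP] := choice (index_exists subT injH rangeH repr_h).
have /choice[sigma sigmaP] : forall p : adj1 S * option I, exists t,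
    set1adj T t /\ p.1 * exth h p.2 = exth h (c (p.1 * exth h p.2)) * t.
  by move=> p; have [_ _ [t ? ?] _] := cP (p.1 * exth h p.2); exists t.
have /choice[tau tauP] : forall p : option I * adj1 S, exists t,
    set1adj T t /\ exth h p.1 * p.2 = t * exth h (c (exth h p.1 * p.2)).
  by move=> p; have [_ _ _ [t ? ?]] := cP (exth h p.1 * p.2); exists t.
pose rho s i := c (s * exth h i); pose lambda i s := c (exth h i * s).
have lambdaP : is_lambda T H h lambda.
  by move=> i s; have [] := cP (exth h i * s).
have T_genB := subsemigroup_genB subT rangeH repr_h genA (rho := rho) lambdaP
  (fun s i => (sigmaP (s, i)).1) (fun i s => (tauP (i, s)).1)
  (fun s i => (sigmaP (s, i)).2) (fun i s => (tauP (i, s)).2).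
eexists; last exact/esym/T_genB.
apply: finite_preimage => [x y _ _ []//|]; apply: finite_genB => //.
have finH : finite_set (range H) by rewrite rangeH; exists m.
have -> : [set: I] = H @^-1` range H by apply/seteqP; split=> // i _; exists i.
by apply: finite_preimage finH => i j _ _; exact: injH.
Qed.

Theorem theorem4p3 (S : semigroupType) (T : set S) (subT : subsemigroup T) :
  (forall (A : set S) (genA : gen A = setT)
      (I : Type) (H : I -> set S) (h : I -> S)
      (injH : injective H) (rangeH : range H = outerHclasses T)
      (repr_h : forall i, H i (h i))
      (rho : adj1 S -> option I -> option I)
      (lambda : option I -> adj1 S -> option I)
      (rhoP : is_rho T H h rho) (lambdaP : is_lambda T H h lambda)
      (sigma : adj1 S -> option I -> adj1 S)
      (tau : option I -> adj1 S -> adj1 S)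
      (sigmaT : forall s i, set1adj T (sigma s i))
      (tauT : forall i s, set1adj T (tau i s))
      (sigmaP : forall (s : adj1 S) i, s * exth h i = exth h (rho s i) * sigma s i)
      (tauP : forall i (s : adj1 S), exth h i * s = tau i s * exth h (lambda i s)),
      T = gen (@in1 S @^-1` genB A sigma tau))
  /\
  (fin_gen [set: S] -> finite_green_index T -> fin_gen T).
Proof.
split; last exact: fin_gen_finite_green_index.
move=> A genA I H h injH rangeH repr_h rho lambda rhoP lambdaP sigma tau.
move=> sigmaT tauT sigmaP tauP.
exact: (subsemigroup_genB subT rangeH repr_h genA lambdaP sigmaT tauT sigmaP).
Qed.
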